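(* Let $\epsilon\in(0,1)$, $\sigma>0$ and an uncertainty set $\mathcal{U}\subset\mathbb{R}^m$ be given, and let $A\in\mathbb{R}^{m\times n}$ satisfy $\mathrm{RIP}(\delta,k)$ with some $\delta\in(0,1)$ and integer $k>1$. Let $r(\mathcal{U})=\max_{u\in\mathcal{U}}\|u\|_2$. Then there exists a matrix $H(A)\in\mathbb{R}^{m\times n}$ which, for every positive integer $s$, satisfies the condition $\mathbf{H}_{s,\infty}(s\gamma(\delta,k))$ with $$\gamma(\delta,k)=\frac{\sqrt2\,\delta}{(1-\delta)\sqrt{k-1}},$$ and is such that $$\nu(H(A))\le\frac{r(\mathcal{U})+\sigma\sqrt{2\ln(n/\epsilon)}}{\sqrt{1-\delta}}.$$ In particular, for every positive integer $s$, $$s\le\frac{1-\delta}{3\sqrt2}\sqrt{k-1}\ \Longrightarrow\ \omega_*\left(\tfrac1{3s}\right)\le\frac1{\sqrt{1-\delta}}\left[r(\mathcal{U})+\sigma\sqrt{2\ln(n/\epsilon)}\right].$$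
   Context: $\mathcal{U}\subset\mathbb{R}^m$ is a (nonempty) convex compact set symmetric with respect to the origin. $\mathrm{RIP}(\delta,k)$ for $A$: $(1-\delta)\|v\|_2^2\le\|Av\|_2^2\le(1+\delta)\|v\|_2^2$ for every $v\in\mathbb{R}^n$ with at most $k$ nonzero entries. $\nu(v)=\sup_{u\in\mathcal{U}}u^Tv+\sigma\sqrt{2\ln(n/\epsilon)}\|v\|_2$ for $v\in\mathbb{R}^m$, and $\nu(H)=\max_i\nu(h_i)$ for $H=[h_1,\dots,h_n]\in\mathbb{R}^{m\times n}$. Condition $\mathbf{H}_{s,\infty}(\kappa)$ on $H\in\mathbb{R}^{m\times n}$: $\|x\|_\infty\le\|H^TAx\|_\infty+s^{-1}\kappa\|x\|_1$ for all $x\in\mathbb{R}^n$. $\omega_*(\gamma)=\max_{1\le i\le n}\min_{h\in\mathbb{R}^m}\{\nu(h):\|A^Th-e_i\|_\infty\le\gamma\}$, with $e_i$ the $i$-th standard basis vector of $\mathbb{R}^n$ (value $+\infty$ if some of the problems is infeasible). *)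

(* Defs.v *)
From HB Require Import structures.
From mathcomp Require Import all_boot all_order all_algebra.
From mathcomp Require Import boolp classical_sets reals ereal topology.
From mathcomp Require Import normedtype convex exp.
Set Implicit Arguments.
Unset Strict Implicit.
Unset Printing Implicit Defensive.
Import Order.TTheory GRing.Theory Num.Theory.
Import numFieldNormedType.Exports.
Local Open Scope classical_set_scope.
Local Open Scope ring_scope.

(* On ['cV[R]_n] the library norm [`|x|] is the norm max_i |x_i|: it is used
   below for ||x||_oo. *)

Definition norm1 (R : realType) (n : nat) (x : 'cV[R]_n) : R :=
  \sum_i `|x i 0|.

Definition norm2 (R : realType) (n : nat) (x : 'cV[R]_n) : R :=
  Num.sqrt (\sum_i x i 0 ^+ 2).

Definition nnz (R : realType) (n : nat) (v : 'cV[R]_n) : nat :=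
  #|[pred i | v i 0 != 0]|.

Definition RIP (R : realType) (m n : nat) (delta : R) (k : nat)
    (A : 'M[R]_(m, n)) : Prop :=
  forall v : 'cV[R]_n, (nnz v <= k)%N ->
    (1 - delta) * norm2 v ^+ 2 <= norm2 (A *m v) ^+ 2 /\
    norm2 (A *m v) ^+ 2 <= (1 + delta) * norm2 v ^+ 2.

(* [sup] is real-valued, and 0 by convention on empty or unbounded sets; for U
   nonempty and compact, [radius2 U] is max_{u in U} ||u||_2. *)
Definition radius2 (R : realType) (m : nat) (U : set 'cV[R]_m) : R :=
  sup [set norm2 u | u in U].

Definition nu (R : realType) (m n : nat) (U : set 'cV[R]_m) (sigma eps : R)
    (v : 'cV[R]_m) : R :=
  sup [set (u^T *m v) 0 0 | u in U]
  + sigma * Num.sqrt (2 * ln (n%:R / eps)) * norm2 v.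

(* The base value 0 is harmless for n > 0: [nu] is nonnegative when U is
   nonempty, compact and symmetric and sigma >= 0. *)
Definition nu_mx (R : realType) (m n : nat) (U : set 'cV[R]_m) (sigma eps : R)
    (H : 'M[R]_(m, n)) : R :=
  \big[Num.max/0]_(i < n) nu n U sigma eps (col i H).

Definition cond_Hinf (R : realType) (m n : nat) (A : 'M[R]_(m, n)) (s : nat)
    (kappa : R) (H : 'M[R]_(m, n)) : Prop :=
  forall x : 'cV[R]_n,
    `|x| <= `|H^T *m A *m x| + s%:R^-1 * kappa * norm1 x.

(* Extended-real valued: an infeasible inner problem has value
   [ereal_inf set0 = +oo]; a feasible one attains its infimum, since for U
   nonempty, compact and symmetric, sigma > 0 and 0 < eps < 1,
   [nu] is continuous and coercive and the feasible set is closed. *)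
Definition omega_star (R : realType) (m n : nat) (U : set 'cV[R]_m)
    (sigma eps : R) (A : 'M[R]_(m, n)) (gamma : R) : \bar R :=
  \big[maxe/-oo%E]_(i < n)
    ereal_inf [set (nu n U sigma eps h)%:E
              | h in [set h : 'cV[R]_m | `|A^T *m h - delta_mx i 0| <= gamma]].

Definition gamma_RIP (R : realType) (delta : R) (k : nat) : R :=
  Num.sqrt 2 * delta / ((1 - delta) * Num.sqrt (k%:R - 1)).

(* Main.v *)
Require Import Defs.
From HB Require Import structures.
From mathcomp Require Import all_boot all_order all_algebra.
From mathcomp Require Import boolp classical_sets reals ereal topology.
From mathcomp Require Import normedtype convex exp.
From mathcomp Require Import ring lra zify.
Set Implicit Arguments.
Unset Strict Implicit.
Unset Printing Implicit Defensive.
Import Order.TTheory GRing.Theory Num.Theory.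
Import numFieldNormedType.Exports.
Local Open Scope classical_set_scope.
Local Open Scope ring_scope.

(** Write [g] for [gamma_RIP delta k] and [rho] for [sqrt (1 - delta)].  All
    the claims follow once, for each coordinate [i], a vector [h] is found with
    [norm2 h <= rho^-1] and all entries of [A^T h - e_i] at most [g] in absolute
    value.  Taking these vectors as the columns of [H], the error
    [x_i - (H^T A x)_i] is the product of [e_i - A^T h_i] with [x], hence at
    most [g * norm1 x]; and [nu h] is at most
    [(radius2 U + sigma * ..) * norm2 h] by Cauchy-Schwarz.  For the last claim,
    the upper bound on [s] gives [g <= 1 / (3 s)], so that [h_i] is feasible in
    the problem that defines [omega_star].

    The existence of [h] is dual to the inequality
    [`|x_i| <= rho^-1 * norm2 (A x) + g * norm1 x], to be proved for all [x].

    Primal inequality ([RIP_coord_le]).  Let [q = k / 2] (rounded down) and let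
    [S] carry the [q] largest entries of [x].  For disjoint supports of total
    size at most [k], polarization turns the RIP into
    [`|<A u, A v>| <= delta * norm2 u * norm2 v] ([RIP_dot]).  Cut the rest of
    [x] into blocks of [q] entries of decreasing size.  An entry of a block is
    at most the mean of the previous block, so the 2-norm of a block is at most
    the 1-norm of the previous one divided by [sqrt q]; summing up,
    [<A x_S, A x>] differs from [norm2 (A x_S) ^+ 2] by at most
    [delta * norm2 x_S * norm1 x / sqrt q] ([dot_tail_le]).  Cauchy-Schwarz and
    the lower RIP bound on [A x_S] then bound [norm2 x_S], which dominates every
    entry of [x].  As [k - 1 <= 2 q], the factor [1 / sqrt q] is at most
    [sqrt 2 / sqrt (k - 1)].

    Duality ([exists_near_inverse_row]).  The function
    [y |-> inf_x (rho^-1 * norm2 (y + A x) + g * norm1 x - x_i)] is finite by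
    the primal inequality, and sublinear; any linear function [<h, .>] below it
    is as required.  Linear minorants of sublinear functions on a
    finite-dimensional space are produced by lowering the function, again by
    an infimal convolution, until it is linear along each vector of a basis
    ([sublinear_flatten], [linear_minorant]). *)

(** * Sublinear functions *)

(** Homogeneity is asked as an inequality for positive scalars: applied to [c]
    and [c^-1] it gives the equality, see [sublinearZ]. *)
Definition sublinear (R : realType) (V : lmodType R) (p : V -> R) : Prop :=
  (forall x y, p (x + y) <= p x + p y) /\
  (forall c x, 0 < c -> p (c *: x) <= c * p x).

Section Sublinear.
Variables (R : realType) (V : lmodType R) (p : V -> R).
Hypothesis p_sub : sublinear p.

Lemma sublinear0 : p 0 = 0.
Proof.
case: p_sub => _ hom; apply/eqP; rewrite eq_le.
have := hom 2 0 (ltr0n _ _); have := hom 2^-1 0 ltac:(by rewrite invr_gt0).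
rewrite !scaler0 => ? ?; apply/andP; split; lra.
Qed.

Lemma sublinearZ c x : 0 <= c -> p (c *: x) = c * p x.
Proof.
rewrite le_eqVlt => /predU1P[<-|c0]; first by rewrite scale0r mul0r sublinear0.
case: p_sub => _ hom; apply/eqP; rewrite eq_le hom //=.
have := hom c^-1 (c *: x); rewrite invr_gt0 => /(_ c0).
by rewrite scalerA mulVf ?gt_eqF// scale1r -ler_pdivrMl ?invr_gt0// invrK.
Qed.

Lemma sublinearN x : - p (- x) <= p x.
Proof.
case: p_sub => add _; have := add x (- x).
by rewrite subrr sublinear0; lra.
Qed.

Lemma sublinear_sum (I : Type) (r : seq I) (F : I -> V) :
  p (\sum_(i <- r) F i) <= \sum_(i <- r) p (F i).
Proof.
elim: r => [|i r IH]; first by rewrite !big_nil sublinear0.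
rewrite !big_cons; case: p_sub => add _.
by apply: le_trans (add _ _) _; rewrite lerD2l.
Qed.

End Sublinear.

(** The infimal convolution [q v = inf_w (p (v + L w) + psi w)].  The
    positivity hypothesis, together with the subadditivity of [p], bounds the
    infimum below by [- p (- v)]; the two bounds on [q] come from [w = 0] and
    from cancelling [v = - L w].  For a linear [g <= q] the latter says
    [- g (L w) <= psi w], which is how constraints are imposed on [g]. *)
Lemma sublinear_infconv (R : realType) (V W : lmodType R)
    (p : V -> R) (psi : W -> R) (L : {linear W -> V}) :
  sublinear p -> sublinear psi -> (forall w, 0 <= p (L w) + psi w) ->
  exists q : V -> R, [/\ sublinear q, forall v, q v <= p v
                       & forall w, q (- L w) <= psi w].
Proof.
move=> p_sub psi_sub pos.
pose Q v := [set p (v + L w) + psi w | w in [set: W]].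
have Q_ne v : Q v !=set0 by exists (p (v + L 0) + psi 0), 0.
have Q_lb v : has_lbound (Q v).
  exists (- p (- v)) => _ [w _ <-]; have [add _] := p_sub.
  have := add (v + L w) (- v); rewrite addrAC subrr add0r.
  by have := pos w; lra.
have qle v w : inf (Q v) <= p (v + L w) + psi w.
  by apply: (ge_inf (Q_lb v)); exists w.
exists (fun v => inf (Q v)); split=> [|v|w]; last 2 first.
- by apply: le_trans (qle v 0) _; rewrite linear0 addr0 sublinear0 ?addr0.
- by apply: le_trans (qle _ w) _; rewrite addNr sublinear0 ?add0r.
split=> [x y|c x c0] /=.
- rewrite -lerBlDr; apply: (lb_le_inf (Q_ne x)) => _ [w _ <-].
  rewrite lerBlDr -lerBlDl; apply: (lb_le_inf (Q_ne y)) => _ [w' _ <-].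
  have := qle (x + y) (w + w'); rewrite linearD addrACA.
  case: p_sub psi_sub => add _ [add' _].
  by have := add (x + L w) (y + L w'); have := add' w w'; lra.
- rewrite -ler_pdivrMl//; apply: (lb_le_inf (Q_ne x)) => _ [w _ <-].
  rewrite ler_pdivrMl//; have := qle (c *: x) (c *: w).
  rewrite linearZ -scalerDr (sublinearZ p_sub _ (ltW c0)).
  by rewrite (sublinearZ psi_sub _ (ltW c0)) -mulrDr; apply: le_trans.
Qed.

(** Convolving [q] with [- t * q v] along the line of [v] makes it odd on that
    line, and lowering an odd restriction further cannot destroy oddness, since
    [0 <= q v + q (- v)] always; so the vectors can be treated one by one. *)
Lemma sublinear_flatten (R : realType) (V : lmodType R) (p : V -> R)
    (vs : seq V) :
  sublinear p ->
  exists q : V -> R, [/\ sublinear q, forall v, q v <= p v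
                       & forall v, v \in vs -> q (- v) <= - q v].
Proof.
elim: vs p => [|v vs IH] p p_sub; first by exists p.
have [q [q_sub qp q_flat]] := IH p p_sub.
have psi_sub : sublinear (fun t : R^o => - (t : R) * q v).
  by split=> [x y|c x _]; rewrite ?opprD ?mulrDl// -mulrN mulrA.
have pos (t : R) : 0 <= q (t *: v) + - t * q v.
  have [t0|t0] := leP 0 t; first by rewrite (sublinearZ q_sub)// mulNr subrr.
  have := sublinearN q_sub (t *: v).
  have nt : 0 <= - t by rewrite oppr_ge0 ltW.
  by rewrite -scaleNr (sublinearZ q_sub _ nt); lra.
have line_lin : linear (fun t : R^o => t *: v).
  by move=> c x y; rewrite scalerDl scalerA.
pose line : {linear R^o -> V} :=
  HB.pack (fun t : R^o => t *: v) (GRing.isLinear.Build _ _ _ _ _ line_lin).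
have [q' [q'_sub q'q q'v]] :=
  @sublinear_infconv _ _ _ q _ line q_sub psi_sub pos.
exists q'; split=> // [u|u]; first exact: le_trans (q'q _) (qp _).
rewrite inE => /predU1P[->|/q_flat]; last first.
  by have := q'q u; have := q'q (- u); lra.
have := q'v 1; have := q'v (-1); rewrite /= scaleN1r scale1r opprK.
lra.
Qed.

(** * Inner product and Euclidean norm *)

Definition dot (R : realType) (n : nat) (u v : 'cV[R]_n) : R :=
  (u^T *m v) 0 0.

Section Dot.
Variables (R : realType) (n : nat).
Implicit Types u v w : 'cV[R]_n.

Lemma dotE u v : dot u v = \sum_i u i 0 * v i 0.
Proof. by rewrite /dot mxE; apply: eq_bigr => i _; rewrite mxE. Qed.

Lemma dotC u v : dot u v = dot v u.
Proof. by rewrite !dotE; apply: eq_bigr => i _; rewrite mulrC. Qed.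

Lemma dotDr u v w : dot u (v + w) = dot u v + dot u w.
Proof. by rewrite /dot mulmxDr mxE. Qed.

Lemma dotZr c u v : dot u (c *: v) = c * dot u v.
Proof. by rewrite /dot -scalemxAr mxE. Qed.

Lemma dotDl u v w : dot (u + v) w = dot u w + dot v w.
Proof. by rewrite dotC dotDr !(dotC w). Qed.

Lemma dotZl c u v : dot (c *: u) v = c * dot u v.
Proof. by rewrite dotC dotZr dotC. Qed.

Lemma norm2_ge0 u : 0 <= norm2 u. Proof. exact: sqrtr_ge0. Qed.

Lemma sqr_norm2 u : norm2 u ^+ 2 = dot u u.
Proof.
rewrite sqr_sqrtr ?sumr_ge0// => [|i _]; last exact: sqr_ge0.
by rewrite dotE; apply: eq_bigr => i _; rewrite expr2.
Qed.

Lemma norm2Z c u : norm2 (c *: u) = `|c| * norm2 u.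
Proof.
apply/eqP; rewrite -(eqrXn2 (n := 2))// ?mulr_ge0 ?norm2_ge0//.
by rewrite exprMn !sqr_norm2 dotZr dotZl real_normK ?num_real// mulrA.
Qed.

Lemma coord_le_norm2 u i : `|u i 0| <= norm2 u.
Proof.
rewrite -sqrtr_sqr ler_wsqrtr// (bigD1 i)//= lerDl.
by apply: sumr_ge0 => j _; apply: sqr_ge0.
Qed.

Lemma norm2_le_sup (c : R) u : 0 <= c -> (forall i, `|u i 0| <= c) ->
  norm2 u <= Num.sqrt (nnz u)%:R * c.
Proof.
move=> c0 uc; rewrite -(ger0_norm c0) -sqrtr_sqr -sqrtrM// ler_wsqrtr//.
rewrite (bigID [pred i | u i 0 != 0])/= [X in _ + X]big1 => [|i]; last first.
  by rewrite negbK => /eqP->; rewrite expr0n.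
rewrite addr0 /nnz -sum1_card natr_sum mulr_suml ler_sum// => i _.
by rewrite mul1r -(real_normK (num_real (u i 0))) ler_sqr ?nnegrE.
Qed.

(** Scaling [P] and [Q] to a common value [P * Q] is the choice [s = Q],
    [t = P]; if one of them is zero, letting the corresponding scalar tend to
    infinity forces [b <= 0].  It yields both Cauchy-Schwarz and [RIP_dot]. *)
Lemma polarization_le (c P Q b : R) : 0 <= c -> 0 <= P -> 0 <= Q ->
  (forall s t, 2 * (s * t) * b <= c * ((s * P) ^+ 2 + (t * Q) ^+ 2)) ->
  b <= c * P * Q.
Proof.
move=> c0 P0 Q0 H.
have [/eqP|PQ0] := eqVneq (P * Q) 0; last first.
  have PQ : 0 < P * Q by rewrite lt_neqAle eq_sym PQ0 mulr_ge0.
  rewrite -(ler_pM2l PQ); have := H Q P.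
  rewrite (_ : c * _ = 2 * (P * Q * (c * P * Q))); last by ring.
  by rewrite (_ : _ * b = 2 * (P * Q * b)); [lra | ring].
have null (X : R) : (forall s, 2 * s * b <= c * X ^+ 2) -> b <= 0.
  move=> HX; rewrite leNgt; apply/negP => b0.
  have := HX ((c * X ^+ 2 + 1) / (2 * b)).
  rewrite (_ : 2 * _ * b = c * X ^+ 2 + 1); first by lra.
  by field; rewrite gt_eqF.
rewrite mulf_eq0 -mulrA => /orP[]/eqP E; rewrite E ?(mulr0, mul0r).
  apply: (null Q) => s; have := H s 1.
  by rewrite E !(mulr1, mulr0, mul1r) expr0n add0r.
apply: (null P) => s; have := H 1 s.
by rewrite E !(mulr1, mulr0, mul1r) expr0n addr0.
Qed.

Lemma norm2_comb s t u v :
  norm2 (s *: u + t *: v) ^+ 2 =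
  (s * norm2 u) ^+ 2 + (t * norm2 v) ^+ 2 + 2 * (s * t) * dot u v.
Proof.
rewrite !exprMn !sqr_norm2 !(dotDr, dotDl, dotZr, dotZl) (dotC v u).
by ring.
Qed.

Lemma dot_le_norm2 u v : dot u v <= norm2 u * norm2 v.
Proof.
rewrite -[leRHS]mul1r mulrA; apply: polarization_le => //; try exact: norm2_ge0.
move=> s t; have := sqr_ge0 (norm2 (s *: u + (- t) *: v)).
by rewrite norm2_comb mul1r mulNr sqrrN mulrN; lra.
Qed.

Lemma norm2D u v : norm2 (u + v) <= norm2 u + norm2 v.
Proof.
rewrite -ler_sqr ?nnegrE ?addr_ge0 ?norm2_ge0//.
have := norm2_comb 1 1 u v; rewrite !scale1r !mul1r => ->.
by rewrite mulr1 sqrrD -addrA addrC; have := dot_le_norm2 u v; lra.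
Qed.

End Dot.

Lemma dot_mulmxr (R : realType) (m n : nat) (A : 'M[R]_(m, n)) u x :
  dot u (A *m x) = dot (A^T *m u) x.
Proof. by rewrite /dot trmx_mul trmxK mulmxA. Qed.

Lemma dot_deltar (R : realType) (n : nat) (u : 'cV[R]_n) i :
  dot u (delta_mx i 0) = u i 0.
Proof. by rewrite /dot -colE !mxE. Qed.

Lemma sublinear_norm2 (R : realType) (n : nat) (c : R) : 0 <= c ->
  sublinear (fun u : 'cV[R]_n => c * norm2 u).
Proof.
move=> c0; split=> [u v|a u a0]; first by rewrite -mulrDr ler_wpM2l ?norm2D.
by rewrite norm2Z gtr0_norm// mulrCA.
Qed.

(** If [q] is odd along every basis vector, then expanding [- y] in the basis
    bounds [q (- y)] by [- <h, y>] with [h_i = q e_i]; hence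
    [<h, y> <= - q (- y) <= q y]. *)
Lemma linear_minorant (R : realType) (m : nat) (p : 'cV[R]_m -> R) :
  sublinear p -> exists h : 'cV[R]_m, forall y, dot h y <= p y.
Proof.
move=> /sublinear_flatten.
move=> /(_ [seq delta_mx i 0 | i <- enum 'I_m]) [q [q_sub qp q_flat]].
have flat i : q (- delta_mx i 0) <= - q (delta_mx i 0).
  by apply: q_flat; apply: map_f; rewrite mem_enum.
have line i t : q (t *: delta_mx i 0) <= t * q (delta_mx i 0).
  have [t0|t0] := leP 0 t; first by rewrite (sublinearZ q_sub).
  have nt : 0 <= - t by rewrite oppr_ge0 ltW.
  rewrite -[t]opprK scaleNr -scalerN (sublinearZ q_sub _ nt).
  by rewrite [leRHS]mulNr -mulrN ler_wpM2l.
exists (\col_i q (delta_mx i 0)) => y.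
apply: le_trans (le_trans (sublinearN q_sub y) (qp y)).
rewrite lerNr {1}(_ : - y = \sum_i - y i 0 *: delta_mx i 0).
  apply: le_trans (sublinear_sum q_sub _ _) _.
  rewrite dotE -sumrN; apply: ler_sum => i _.
  by apply: le_trans (line _ _) _; rewrite mxE mulNr mulrC.
apply/matrixP => i j; rewrite ord1 summxE (bigD1 i)//= !mxE !eqxx mulr1.
rewrite big1 ?addr0// => l li.
by rewrite !mxE eq_sym (negPf li) mulr0.
Qed.

(** * Duality *)

Lemma norm1_ge0 (R : realType) (n : nat) (x : 'cV[R]_n) : 0 <= norm1 x.
Proof. exact: sumr_ge0. Qed.

(** Take for [<h, .>] a linear minorant of the infimal convolution of
    [y |-> theta * norm2 y] with [x |-> gamma * norm1 x - x i 0] along [A].  Then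
    [<h, y> <= theta * norm2 y], which at [y = h] is [norm2 h <= theta]; and
    [- <h, A x> <= gamma * norm1 x - x i 0], which at [x = e_j] and [x = - e_j]
    bounds the [j]-th entry of [A^T h - e_i]. *)
Lemma exists_near_inverse_row (R : realType) (m n : nat) (A : 'M[R]_(m, n))
    (i : 'I_n) (theta gamma : R) : 0 <= theta -> 0 <= gamma ->
  (forall x : 'cV[R]_n, x i 0 <= theta * norm2 (A *m x) + gamma * norm1 x) ->
  exists2 h : 'cV[R]_m, norm2 h <= theta
    & forall j, `|(A^T *m h - delta_mx i 0) j 0| <= gamma.
Proof.
move=> theta0 gamma0 hyp.
pose psi (x : 'cV[R]_n) := gamma * norm1 x - x i 0.
have psi_sub : sublinear psi.
  split=> [x y|c x c0]; rewrite /psi !mxE.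
    suff: norm1 (x + y) <= norm1 x + norm1 y.
      by move=> /(ler_wpM2l gamma0); lra.
    by rewrite -big_split; apply: ler_sum => j _; rewrite mxE ler_normD.
  suff -> : norm1 (c *: x) = c * norm1 x by lra.
  by rewrite mulr_sumr; apply: eq_bigr => j _; rewrite mxE normrM gtr0_norm.
have [|q [q_sub q_norm q_A]] :=
    @sublinear_infconv _ _ _ _ _ (mulmx A) (sublinear_norm2 m theta0) psi_sub.
  by move=> x; have := hyp x; rewrite /psi; lra.
have [h hq] := linear_minorant q_sub.
exists h => [|j].
  have := le_trans (hq h) (q_norm h); rewrite -sqr_norm2 expr2.
  have [->|h0] := eqVneq (norm2 h) 0; first by [].
  by rewrite ler_pM2r// lt_neqAle eq_sym h0 norm2_ge0.
have psi_delta (c : R) :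
    psi (c *: delta_mx j 0) = gamma * `|c| - c * (i == j)%:R.
  rewrite /psi !mxE eqxx andbT; congr (_ * _ - _).
  rewrite /norm1 (bigD1 j)//= big1 => [|l lj]; last first.
    by rewrite !mxE (negPf lj) mulr0 normr0.
  by rewrite !mxE !eqxx mulr1 addr0.
have bound (c : R) : - (c * (A^T *m h) j 0) <= gamma * `|c| - c * (i == j)%:R.
  rewrite -psi_delta -dot_deltar -dot_mulmxr.
  apply: le_trans (q_A _); apply: le_trans (hq _).
  by rewrite /= -scalemxAr -scaleN1r !dotZr mulN1r.
have := bound 1; have := bound (-1); rewrite normrN1 normr1 !mxE andbT eq_sym.
by rewrite ler_norml => ? ?; apply/andP; split; lra.
Qed.

(** * Consequences of the restricted isometry property *)

Definition restr (R : realType) (n : nat) (T : {set 'I_n}) (x : 'cV[R]_n)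
    : 'cV[R]_n :=
  \col_i (if i \in T then x i 0 else 0).

Lemma nnz_restr (R : realType) (n : nat) (T : {set 'I_n}) (x : 'cV[R]_n) :
  (nnz (restr T x) <= #|T|)%N.
Proof.
apply/subset_leq_card/fintype.subsetP => i; rewrite inE mxE.
by case: ifP => // _; rewrite eqxx.
Qed.

Lemma restr_setD (R : realType) (n : nat) (S T : {set 'I_n}) (x : 'cV[R]_n) :
  S \subset T -> restr T x = restr S x + restr (T :\: S) x.
Proof.
move=> /fintype.subsetP ST; apply/matrixP => i j; rewrite !mxE inE.
by case: (boolP (i \in S)) => [/ST ->|_] /=; rewrite ?addr0 ?add0r.
Qed.

(** [S] has fewer than [q] elements only when it exhausts [T]; this is why the
    cardinality is asserted only in the presence of a remaining index. *)
Definition top_block (R : realType) (I : finType) (f : I -> R) (q : nat)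
    (T S : {set I}) : Prop :=
  [/\ S \subset T, (#|S| <= q)%N
    & forall j, j \in T :\: S ->
        #|S| = q /\ forall i, i \in S -> f j <= f i].

Lemma exists_top_block (R : realType) (I : finType) (f : I -> R) (q : nat)
    (T : {set I}) :
  exists S, top_block f q T S.
Proof.
elim: q => [|q [S [ST Sq Smax]]].
  exists finset.set0; split=> [||j _]; rewrite ?finset.sub0set ?cards0//.
  by split=> // i; rewrite inE.
have [TS0|[j0 j0TS]] := finset.set_0Vmem (T :\: S).
  by exists S; split=> // [|j]; [rewrite ltnW | rewrite TS0 inE].
case: (arg_maxP f j0TS) => j jTS jmax.
have [Sq' Sj] := Smax j jTS.
have [jS jT] : j \notin S /\ j \in T.
  by apply/andP; rewrite -finset.in_setD.
exists (j |: S); split=> [||l].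
- by rewrite finset.subUset finset.sub1set ST jT.
- by rewrite cardsU1 jS Sq'.
rewrite cardsU1 jS Sq' => lT.
have lTS : l \in T :\: S.
  by move: lT; rewrite !inE negb_or => /andP[/andP[_ ->] ->].
split=> // i; rewrite !inE => /predU1P[->|]; first exact: jmax.
by have [_ +] := Smax l lTS; apply.
Qed.

(** Every entry outside [S] is at most the mean [M] of the [q] entries on [S],
    and a vector with [q] entries of size at most [M] has 2-norm at most
    [sqrt q * M]. *)
Lemma norm2_next_block (R : realType) (n q : nat) (x : 'cV[R]_n)
    (T S B : {set 'I_n}) :
  (0 < q)%N -> top_block (fun i => `|x i 0|) q T S ->
  B \subset T :\: S -> (#|B| <= q)%N ->
  norm2 (restr B x) <= (Num.sqrt q%:R)^-1 * \sum_(i in S) `|x i 0|.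
Proof.
move=> q0 [_ _ Smax] BTS Bq; set w := Num.sqrt _.
have w0 : 0 < w by rewrite sqrtr_gt0 ltr0n.
have wq : w ^+ 2 = q%:R by rewrite sqr_sqrtr.
pose M := q%:R^-1 * \sum_(i in S) `|x i 0|.
have M0 : 0 <= M by rewrite mulr_ge0 ?invr_ge0 ?ler0n// sumr_ge0.
have BM i : `|restr B x i 0| <= M.
  rewrite mxE; case: ifP => [iB|_]; last by rewrite normr0.
  have [Sq iS] := Smax i (fintype.subsetP BTS i iB).
  rewrite ler_pdivlMl ?ltr0n// -Sq mulr_natl -sumr_const.
  exact: ler_sum.
apply: le_trans (norm2_le_sup M0 BM) _.
rewrite (_ : w^-1 * _ = w * M); last first.
  by rewrite /M -wq mulrA; congr (_ * _); clearbody w; field; rewrite gt_eqF.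
rewrite ler_wpM2r// ler_wsqrtr// ler_nat.
exact: leq_trans (nnz_restr _ _) Bq.
Qed.

(** Induction on [T]: peel the top block [B] off [T :\: S].  The contribution of
    [B] is paid for by the entries on [S], and the contribution of what remains
    by the entries on [T :\: S], so no entry is charged twice. *)
Lemma dot_tail_le (R : realType) (n q : nat) (a x : 'cV[R]_n) (c : R)
    (T S : {set 'I_n}) :
  (0 < q)%N -> 0 <= c -> top_block (fun i => `|x i 0|) q T S ->
  (forall B : {set 'I_n}, B \subset T :\: S -> (#|B| <= q)%N ->
     `|dot a (restr B x)| <= c * norm2 (restr B x)) ->
  `|dot a (restr (T :\: S) x)|
    <= c * ((Num.sqrt q%:R)^-1 * \sum_(i in T) `|x i 0|).
Proof.
move=> q0 c0.
have [N] := ubnP #|T|; elim: N T S => // N IH T S TN TS blk.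
set w := Num.sqrt q%:R.
have w0 : 0 < w by rewrite sqrtr_gt0 ltr0n.
have [TS0|[j0 j0TS]] := finset.set_0Vmem (T :\: S).
  rewrite TS0 dotE big1 ?normr0 => [|i _]; last by rewrite mxE inE mulr0.
  by rewrite mulr_ge0// mulr_ge0 ?sumr_ge0// invr_ge0 ltW.
have [B TSB] := exists_top_block (fun i => `|x i 0|) q (T :\: S).
have [BTS Bq _] := TSB.
have TS_lt : (#|T :\: S| < N)%N.
  have [ST _ /(_ j0 j0TS)[Sq _]] := TS.
  have := subset_leq_card ST; rewrite cardsD (finset.setIidPr ST) Sq.
  by move: TN q0; clear; move: #|T| => t; lia.
have dot_B : `|dot a (restr B x)| <= c * (w^-1 * \sum_(i in S) `|x i 0|).
  apply: le_trans (blk B BTS Bq) _; rewrite ler_wpM2l//.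
  exact: norm2_next_block q0 TS BTS Bq.
have dot_rest := IH _ _ TS_lt TSB _.
rewrite (restr_setD _ BTS) dotDr; apply: le_trans (ler_normD _ _) _.
apply: le_trans (lerD dot_B (dot_rest _)) _.
  move=> C CTS; apply: blk; apply: fintype.subset_trans CTS _.
  exact: finset.subsetDl.
rewrite -!mulrDr ler_wpM2l// ler_wpM2l ?invr_ge0 ?sqrtr_ge0//.
by have [ST _ _] := TS; rewrite [leRHS](big_setID S)/= (finset.setIidPr ST).
Qed.

(** Vectors with disjoint supports are orthogonal, so [s *: u + t *: v] and
    [s *: u - t *: v] have the same 2-norm; the RIP bounds the difference of the
    squared norms of their images, which is [4 s t <A u, A v>]. *)
Lemma RIP_dot (R : realType) (m n : nat) (delta : R) (k : nat)
    (A : 'M[R]_(m, n)) (u v : 'cV[R]_n) :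
  0 <= delta -> RIP delta k A -> (forall i, u i 0 * v i 0 = 0) ->
  (nnz u + nnz v <= k)%N ->
  `|dot (A *m u) (A *m v)| <= delta * norm2 u * norm2 v.
Proof.
move=> delta0 A_RIP.
suff le_dot (w : 'cV[R]_n) : (forall i, u i 0 * w i 0 = 0) ->
    (nnz u + nnz w <= k)%N ->
    dot (A *m u) (A *m w) <= delta * norm2 u * norm2 w.
  move=> uv uvk; rewrite ler_norml lerNl le_dot// andbT.
  rewrite -mulN1r -dotZr scalemxAr.
  have -> : norm2 v = norm2 (-1 *: v) by rewrite norm2Z normrN1 mul1r.
  apply: le_dot => [i|]; first by rewrite mxE mulrCA uv mulr0.
  apply: leq_trans uvk; rewrite leq_add2l.
  apply/subset_leq_card/fintype.subsetP => i.
  by rewrite !inE mxE mulN1r oppr_eq0.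
move=> uw uwk.
have uw0 : dot u w = 0 by rewrite dotE big1// => i _.
have sparse s t : (nnz (s *: u + t *: w) <= k)%N.
  apply: leq_trans uwk; rewrite /nnz -cardUI.
  apply: leq_trans (leq_addr _ _).
  apply/subset_leq_card/fintype.subsetP => i; rewrite !inE !mxE.
  apply: contraR; rewrite negb_or !negbK => /andP[/eqP-> /eqP->].
  by rewrite !mulr0 addr0.
apply: polarization_le; rewrite ?norm2_ge0// => s t.
have [_] := A_RIP _ (sparse s t).
have [+ _] := A_RIP _ (sparse s (- t)).
rewrite !mulmxDr -!scalemxAr !norm2_comb uw0 !mulr0 !addr0.
rewrite !mulNr !sqrrN !mulrN !mulNr.
move: (dot _ _) => b; move: (_ ^+ 2 + _ ^+ 2) => N.
lra.
Qed.

(** The head [x_S] on the [q] largest entries dominates each entry of [x].  With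
    [X = norm2 x_S], [Y = norm2 (A x_S)], [Z = norm2 (A x)],
    [e = norm1 x / sqrt q] and [r = sqrt (1 - delta)] one has [r * X <= Y] and
    [Y ^+ 2 <= Y * Z + delta * X * e]; dividing the latter by [Y] gives
    [r * X <= Z + delta * e / r]. *)
Lemma RIP_coord_le (R : realType) (m n : nat) (delta : R) (k : nat)
    (A : 'M[R]_(m, n)) (x : 'cV[R]_n) (i : 'I_n) :
  0 <= delta < 1 -> (1 < k)%N -> RIP delta k A ->
  `|x i 0| <= (Num.sqrt (1 - delta))^-1 * norm2 (A *m x)
              + gamma_RIP delta k * norm1 x.
Proof.
move=> /andP[d0 d1] k1 A_RIP.
(* Two blocks must fit in [k] entries: the head and one block of the tail. *)
pose q := k./2.
have q0 : (0 < q)%N by rewrite /q; lia.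
have qk : (q + q <= k)%N by rewrite /q; lia.
have kq : (k <= (2 * q).+1)%N by rewrite /q; lia.
have [S topS] := exists_top_block (fun i => `|x i 0|) q finset.setT.
have [_ Sq Smax] := topS.
set X := norm2 (restr S x).
have in_S j : j \in S -> `|x j 0| <= X.
  by move=> jS; have := coord_le_norm2 (restr S x) j; rewrite mxE jS.
have x_X : `|x i 0| <= X.
  have [|iS] := boolP (i \in S); first exact: in_S.
  have [|Sq' iSmax] := Smax i; first by rewrite !inE iS.
  have [j jS] : exists j, j \in S by apply/card_gt0P; rewrite Sq'.
  exact: le_trans (iSmax j jS) (in_S j jS).
apply: le_trans x_X _.
pose w : R := Num.sqrt q%:R.
have w0 : 0 < w by rewrite sqrtr_gt0 ltr0n.
set e := w^-1 * norm1 x.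
have X0 : 0 <= X := norm2_ge0 _.
set Y := norm2 (A *m restr S x); set Z := norm2 (A *m x).
pose tail := restr (finset.setT :\: S) x.
have tail_lb : - (delta * X * e) <= dot (A *m restr S x) (A *m tail).
  suff: `|dot (A *m restr S x) (A *m tail)| <= delta * X * e.
    by rewrite ler_norml => /andP[].
  rewrite dot_mulmxr (_ : e = w^-1 * \sum_(j in finset.setT) `|x j 0|).
    apply: dot_tail_le (mulr_ge0 d0 X0) topS _ => // B BS Bq.
    rewrite -dot_mulmxr; apply: RIP_dot A_RIP _ _ => // [j|].
      rewrite !mxE; case: (boolP (j \in B)) => [/(fintype.subsetP BS)|_].
        by rewrite !inE => /andP[/negPf->]; rewrite mul0r.
      by rewrite mulr0.
    apply: leq_trans qk; apply: leq_add.
      exact: leq_trans (nnz_restr _ _) Sq.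
    exact: leq_trans (nnz_restr _ _) Bq.
  by congr (_ * _); apply: eq_bigl => j; rewrite inE.
have Y_sq : Y ^+ 2 <= Y * Z + delta * X * e.
  have := dot_le_norm2 (A *m restr S x) (A *m x).
  have {2}-> : x = restr S x + tail.
    rewrite -restr_setD ?finset.subsetT//.
    by apply/matrixP => l o; rewrite mxE inE ord1.
  by rewrite mulmxDr dotDr -sqr_norm2 -/Y -/Z; lra.
have Y_lb : (1 - delta) * X ^+ 2 <= Y ^+ 2.
  have [|//] := A_RIP (restr S x) _; apply: leq_trans (nnz_restr _ _) _.
  by apply: leq_trans Sq _; apply: leq_trans qk; rewrite leq_addr.
have e0 : 0 <= e by rewrite mulr_ge0 ?norm1_ge0// invr_ge0 ltW.
have Y0 : 0 <= Y := norm2_ge0 _.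
have Z0 : 0 <= Z := norm2_ge0 _.
pose r := Num.sqrt (1 - delta); rewrite -/r.
have r0 : 0 < r by rewrite sqrtr_gt0 subr_gt0.
have rr : r ^+ 2 = 1 - delta by rewrite sqr_sqrtr// subr_ge0 ltW.
clearbody r.
have rXY : r * X <= Y.
  by rewrite -ler_sqr ?nnegrE ?mulr_ge0 ?(ltW r0)// exprMn rr.
have main : X <= r^-1 * Z + delta / (1 - delta) * e.
  rewrite -rr -(ler_pM2l r0) mulrDr mulrA divff ?gt_eqF// mul1r.
  rewrite [X in Z + X](_ : _ = delta / r * e); last by field; rewrite gt_eqF.
  apply: (le_trans rXY).
  have [Yeq|Yneq] := eqVneq Y 0.
    by rewrite Yeq addr_ge0// mulr_ge0// divr_ge0// ltW.
  have Yp : 0 < Y by rewrite lt_neqAle eq_sym Yneq.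
  rewrite -(ler_pM2l Yp) -expr2; apply: le_trans Y_sq _.
  rewrite mulrDr lerD2l (_ : Y * (_ * e) = delta * (Y / r) * e); last by ring.
  by rewrite ler_wpM2r// ler_wpM2l// ler_pdivlMr// mulrC.
apply: le_trans main _; rewrite lerD2l /e mulrA ler_wpM2r ?norm1_ge0//.
have k1' : 0 < k%:R - 1 :> R by rewrite subr_gt0 ltr1n.
rewrite /gamma_RIP; set v := Num.sqrt (k%:R - 1).
have v0 : 0 < v by rewrite sqrtr_gt0.
rewrite [leRHS](_ : _ = delta / (1 - delta) * (Num.sqrt 2 / v)); last first.
  by field; rewrite !gt_eqF// subr_gt0.
rewrite ler_wpM2l ?divr_ge0 ?subr_ge0 ?(ltW d1)//.
rewrite ler_pdivlMr// mulrC ler_pdivrMr// -sqrtrM ?ler0n// ler_wsqrtr//.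
by rewrite lerBlDr -natrM natr1 ler_nat.
Qed.

Lemma gamma_RIP_ge0 (R : realType) (delta : R) (k : nat) :
  0 <= delta <= 1 -> 0 <= gamma_RIP delta k.
Proof.
by move=> /andP[d0 d1]; rewrite divr_ge0 ?mulr_ge0 ?sqrtr_ge0 ?subr_ge0.
Qed.

Lemma gamma_RIP_le (R : realType) (delta : R) (k s : nat) :
  0 < delta < 1 -> (1 < k)%N -> (0 < s)%N ->
  s%:R <= (1 - delta) / (3 * Num.sqrt 2) * Num.sqrt (k%:R - 1) ->
  gamma_RIP delta k <= (3 * s%:R)^-1.
Proof.
move=> /andP[delta_gt0 delta_lt1] k_gt1 s_gt0 s_le.
have s0 : 0 < s%:R :> R by rewrite ltr0n.
rewrite -[leRHS]mul1r ler_pdivlMr ?mulr_gt0//.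
rewrite /gamma_RIP; set v := Num.sqrt (k%:R - 1) in s_le *.
have v0 : 0 < v by rewrite sqrtr_gt0 subr_gt0 ltr1n.
have d0 : 0 < 1 - delta by rewrite subr_gt0.
have r0 : 0 < Num.sqrt 2 :> R by rewrite sqrtr_gt0.
rewrite mulrAC ler_pdivrMr ?mulr_gt0// mul1r.
move: s_le; rewrite mulrAC ler_pdivlMr ?mulr_gt0// => s_le.
apply: le_trans s_le.
rewrite (_ : s%:R * _ = Num.sqrt 2 * (3 * s%:R)); last by ring.
rewrite ler_wpM2r ?mulr_ge0 ?ler0n//.
by rewrite ger_pMr// ltW.
Qed.

(** * Bounds on nu and on the error of a near inverse *)

Lemma mx_norm_leP (R : realType) (n : nat) (x : 'cV[R]_n) (c : R) : 0 <= c ->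
  reflect (forall i, `|x i 0| <= c) (`|x| <= c).
Proof.
move=> c0; rewrite [`|x|]mx_normrE; apply: (iffP (bigmax_leP _ _ _ _)).
  by move=> [_ xc] i; apply: (xc (i, 0)).
by move=> xc; split=> // -[i j] _ /=; rewrite ord1.
Qed.

Lemma norm_le_near_inverse (R : realType) (m n : nat) (A H : 'M[R]_(m, n))
    (g : R) :
  0 <= g ->
  (forall i j, `|(A^T *m col i H - delta_mx i 0) j 0| <= g) ->
  forall x : 'cV[R]_n, `|x| <= `|H^T *m A *m x| + g * norm1 x.
Proof.
move=> g0 H_g x.
have rhs0 : 0 <= `|H^T *m A *m x| + g * norm1 x.
  by rewrite addr_ge0// mulr_ge0// norm1_ge0.
apply/mx_norm_leP => // i.
have HAx : (H^T *m A *m x) i 0 = dot (A^T *m col i H) x.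
  rewrite -dot_mulmxr -mulmxA dotE mxE.
  by apply: eq_bigr => j _; rewrite !mxE.
have -> : x i 0 = (H^T *m A *m x) i 0
                  - dot (A^T *m col i H - delta_mx i 0) x.
  rewrite HAx dotDl -[- delta_mx _ _]scaleN1r dotZl.
  by rewrite [dot (delta_mx _ _) _]dotC dot_deltar; ring.
apply: le_trans (ler_normB _ _) _; apply: lerD.
  have : `|H^T *m A *m x| <= `|H^T *m A *m x| by [].
  by move=> /(mx_norm_leP _ (normr_ge0 _)).
rewrite dotE; apply: le_trans (ler_norm_sum _ _ _) _.
by rewrite mulr_sumr; apply: ler_sum => j _; rewrite normrM ler_wpM2r.
Qed.

(** [sup] is an upper bound of a set of reals only if that set is bounded,
    which compactness provides. *)
Lemma norm2_le_radius2 (R : realType) (m : nat) (U : set 'cV[R]_m) u :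
  compact U -> U u -> norm2 u <= radius2 U.
Proof.
move=> /compact_bounded[M0 [_ bnd]] Uu.
apply: ub_le_sup; last by exists u.
pose M := `|M0| + 1.
have M0M : M0 < M by rewrite ltr_pwDr// ler_norm.
have M_ge0 : 0 <= M by rewrite addr_ge0.
exists (Num.sqrt m%:R * M) => _ [v Uv <-].
have := bnd M M0M v Uv => /(mx_norm_leP _ M_ge0) /(norm2_le_sup M_ge0).
move=> /le_trans; apply; rewrite ler_wpM2r// ler_wsqrtr// ler_nat.
by rewrite -[leqRHS]card_ord max_card.
Qed.

Lemma nu_le (R : realType) (m n : nat) (U : set 'cV[R]_m) (sigma eps c : R)
    (h : 'cV[R]_m) :
  U !=set0 -> compact U -> 0 <= sigma -> norm2 h <= c ->
  nu n U sigma eps h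
    <= c * (radius2 U + sigma * Num.sqrt (2 * ln (n%:R / eps))).
Proof.
move=> [u0 Uu0] cU sigma0 hc.
have c0 : 0 <= c := le_trans (norm2_ge0 h) hc.
rewrite mulrDr [c * (_ * _)]mulrC; apply: lerD; last first.
  by rewrite ler_wpM2l// mulr_ge0// sqrtr_ge0.
apply: ge_sup; first by exists ((u0^T *m h) 0 0), u0.
move=> _ [u Uu <-]; apply: le_trans (dot_le_norm2 u h) _; rewrite mulrC.
apply: ler_pM; rewrite ?norm2_ge0//.
exact: norm2_le_radius2.
Qed.

(** * The proposition *)

Theorem proposition5 (R : realType) (m n : nat) (n_gt0 : (0 < n)%N)
    (eps sigma : R) (eps_gt0 : 0 < eps) (eps_lt1 : eps < 1)
    (sigma_gt0 : 0 < sigma)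
    (U : set 'cV[R]_m) (U_neq0 : U !=set0)
    (U_convex : convex_set U) (U_compact : compact U)
    (U_sym : forall u : 'cV[R]_m, U u -> U (- u))
    (A : 'M[R]_(m, n)) (delta : R) (delta_gt0 : 0 < delta)
    (delta_lt1 : delta < 1) (k : nat) (k_gt1 : (1 < k)%N)
    (A_RIP : RIP delta k A) :
  (exists H : 'M[R]_(m, n),
     (forall s : nat, (0 < s)%N ->
        cond_Hinf A s (s%:R * gamma_RIP delta k) H) /\
     nu_mx U sigma eps H <=
       (radius2 U + sigma * Num.sqrt (2 * ln (n%:R / eps)))
         / Num.sqrt (1 - delta)) /\
  (forall s : nat, (0 < s)%N ->
     s%:R <= (1 - delta) / (3 * Num.sqrt 2) * Num.sqrt (k%:R - 1) ->
     (omega_star U sigma eps A (3 * s%:R)^-1 <=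
       ((Num.sqrt (1 - delta))^-1 *
        (radius2 U + sigma * Num.sqrt (2 * ln (n%:R / eps))))%:E)%E).
Proof.
set rho := Num.sqrt (1 - delta); set c := radius2 U + _; set g := gamma_RIP _ _.
have g0 : 0 <= g by apply: gamma_RIP_ge0; rewrite !ltW.
have rhoV0 : 0 <= rho^-1 by rewrite invr_ge0 sqrtr_ge0.
have c0 : 0 <= c.
  rewrite addr_ge0 ?mulr_ge0 ?sqrtr_ge0 ?(ltW sigma_gt0)//.
  case: U_neq0 => u Uu.
  exact: le_trans (norm2_ge0 u) (norm2_le_radius2 U_compact Uu).
have rows i : exists h : 'cV[R]_m, norm2 h <= rho^-1 /\
    forall j, `|(A^T *m h - delta_mx i 0) j 0| <= g.
  have [//|//|x|h h_rho h_g] :=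
    @exists_near_inverse_row _ _ _ A i rho^-1 g; last by exists h.
  apply: le_trans (ler_norm _) _; apply: RIP_coord_le => //.
  by rewrite ltW.
have [h h_rows] := choice rows.
have nu_h i : nu n U sigma eps (h i) <= rho^-1 * c.
  by apply: nu_le => //; [exact: ltW | have [] := h_rows i].
split=> [|s s_gt0 s_le].
  pose H : 'M[R]_(m, n) := \matrix_(j, i) h i j 0.
  have col_H i : col i H = h i.
    by apply/matrixP => j o; rewrite !mxE ord1.
  exists H; split=> [s s_gt0 x|].
    rewrite mulrA mulVf ?pnatr_eq0 ?lt0n_neq0// mul1r.
    apply: norm_le_near_inverse => // i j; rewrite col_H.
    by have [_] := h_rows i.
  rewrite mulrC; apply: bigmax_le => [|i _]; first exact: mulr_ge0.
  by rewrite col_H.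
have g_le : g <= (3 * s%:R)^-1 by apply: gamma_RIP_le; rewrite ?delta_gt0.
apply: bigmax_le => [|i _]; first exact: leNye.
apply: (@le_trans _ _ (nu n U sigma eps (h i))%:E).
  apply: ereal_inf_lbound; exists (h i) => //=.
  apply/mx_norm_leP => [|j]; first exact: le_trans g0 g_le.
  by apply: le_trans g_le; have [_] := h_rows i.
by rewrite lee_fin; apply: nu_h.
Qed.
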